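(* Let $\alpha\in(0,1]$ and let $\mathbf E=(E^S_t)$ be a dynamic intersection $e$-process collection. If $\mathbf E$ is future-extension coherent, then for every $t$ and every finite $J\subseteq\mathcal I$ with $I_t\subseteq J$, $$\mathfrak R^{J}_{\alpha,t}(\mathbf E)=\mathfrak R_{\alpha,t}(\mathbf E).$$ If the collection is projectively consistent, then every future-horizon constraint is exactly the corresponding current constraint after inactive indices are removed: for every $R\subseteq I_t$ and every $S\subseteq J$ with $S\cap I_t\neq\varnothing$, the constraint $\mathrm{FDP}_{S\cap I_t}(R)\le\alpha E^S_t$ is identical to the constraint $\mathrm{FDP}_{S\cap I_t}(R)\le\alpha E^{S\cap I_t}_t$.
   Context: Let $(\Omega,\mathcal F,(\mathcal F_t)_{t\in\mathbb N_0})$ be a discrete-time filtered measurable space, $\mathcal M$ a family of probability measures on $(\Omega,\mathcal F)$, $\mathcal I\subseteq\mathbb N$ an index set (finite or infinite), and $H_i\subseteq\mathcal M$, $i\in\mathcal I$, null hypotheses. For finite $S\subseteq\mathcal I$, $H_S=\bigcap_{i\in S}H_i$ (with $H_\varnothing=\mathcal M$). The active sets $I_t\subseteq\mathcal I$ are deterministic and finite with $I_0\subseteq I_1\subseteq\cdots$ and $\bigcup_t I_t=\mathcal I$. For a finite $R\subseteq\mathcal I$ and any $S\subseteq\mathcal I$, $\mathrm{FDP}_S(R)=|S\cap R|/(|R|\vee 1)$. A nonnegative $(\mathcal F_t)$-adapted process $E=(E_t)_{t\ge0}$ is an $e$-process for $H\subseteq\mathcal M$ if $\mathbb E_P[E_\tau]\le1$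 for every $P\in H$ and every $(\mathcal F_t)$-stopping time $\tau$ with $P(\tau<\infty)=1$. A dynamic intersection $e$-process collection is a family $\mathbf E=(E^S_t)_{t\ge0,\ S\subseteq\mathcal I,\ 0<|S|<\infty}$ such that $E^S=(E^S_t)_{t\ge0}$ is an $e$-process for $H_S$ for each nonempty finite $S$. It is future-extension coherent if, pointwise on $\Omega$, $E_t^{S\cap I_t}\le E_t^S$ for every $t$ and every finite $S$ with $S\cap I_t\ne\varnothing$. It is projectively consistent if it can be extended to the empty index set by an adapted process $E^\varnothing$ such that, pointwise on $\Omega$, $E^S_t=E^{S\cap I_t}_t$ for every finite $S$ and every $t$. Define $\mathfrak R_{\alpha,t}(\mathbf E)=\{R\subseteq I_t:\ \mathrm{FDP}_S(R)\le\alpha E^S_t\text{ for every nonempty }S\subseteq I_t\}$ and, for finite $J$ with $I_t\subseteq J\subseteq\mathcal I$, $\mathfrak R^{J}_{\alpha,t}(\mathbf E)=\{R\subseteq I_t:\ \mathrm{FDP}_{S\cap I_t}(R)\le\alpha E^S_t\text{ for every }S\subseteq J\text{ with }S\cap I_t\ne\varnothing\}$. *)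

(* Defs.v *)
From HB Require Import structures.
From mathcomp Require Import all_boot all_order all_algebra.
From mathcomp Require Import finmap.
From mathcomp Require Import all_classical all_reals all_analysis.
From mathcomp Require Import measurable_realfun.

Set Implicit Arguments.
Unset Strict Implicit.
Unset Printing Implicit Defensive.

Import Order.TTheory GRing.Theory Num.Theory.

Local Open Scope classical_set_scope.
Local Open Scope ring_scope.

Section Processes.
Context {d : measure_display} {T : measurableType d} {R : realType}.
Implicit Types (F : nat -> set (set T)) (X : nat -> T -> \bar R).

Definition filtration F : Prop :=
  [/\ forall t, sigma_algebra setT (F t),
      forall t, F t `<=` measurable
    & forall s t, (s <= t)%N -> F s `<=` F t].

Definition adapted F X : Prop :=
  forall t (B : set (\bar R)), measurable B -> F t (X t @^-1` B).

(* [None] is the value +oo of a random time. *)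
Definition stopping_time F (tau : T -> option nat) : Prop :=
  forall t, F t [set w | exists2 k, (k <= t)%N & tau w = Some k].

(* The value 0 on {tau = +oo} is immaterial: in [e_process] this event is
   null. *)
Definition stopped X (tau : T -> option nat) (w : T) : \bar R :=
  if tau w is Some k then X k w else 0%E.

(* Nonnegative processes take values in [0, +oo]; finite-valued ones are a
   special case. *)
Definition e_process F (H : set (probability T R)) X : Prop :=
  [/\ forall t w, (0 <= X t w)%E,
      adapted F X
    & forall (P : probability T R) (tau : T -> option nat),
        H P -> stopping_time F tau -> P [set w | tau w <> None] = 1%E ->
        (\int[P]_w stopped X tau w <= 1)%E].

End Processes.

Section Collections.
Context {d : measure_display} {T : measurableType d} {R : realType}.
Implicit Types (F : nat -> set (set T)) (M : set (probability T R)).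
Implicit Types (H : nat -> set (probability T R)).
Implicit Types (I : set nat) (A : nat -> {fset nat}).
Implicit Types (E : {fset nat} -> nat -> T -> \bar R).

Definition active_sets I A : Prop :=
  [/\ forall t, [set` A t] `<=` I,
      forall s t, (s <= t)%N -> (A s `<=` A t)%fset
    & \bigcup_t [set` A t] = I].

(* Intersecting inside [M] gives [M] itself for [S] empty. *)
Definition intersection_null M H (S : {fset nat}) : set (probability T R) :=
  M `&` \bigcap_(i in [set` S]) H i.

(* A collection is a total function of the index set; its value at [fset0]
   and at sets not included in [I] is never used. *)
Definition intersection_e_collection F M H I E : Prop :=
  forall S : {fset nat}, [set` S] `<=` I -> S != fset0 ->
    e_process F (intersection_null M H S) (E S).

Definition future_extension_coherent I A E : Prop :=
  forall t (S : {fset nat}), [set` S] `<=` I -> (S `&` A t)%fset != fset0 ->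
    forall w, (E (S `&` A t)%fset t w <= E S t w)%E.

Definition extend_empty E (E0 : nat -> T -> \bar R) (S : {fset nat}) :=
  if S == fset0 then E0 else E S.

Definition projectively_consistent F I A E : Prop :=
  exists2 E0 : nat -> T -> \bar R, adapted F E0 &
    forall (S : {fset nat}) t w, [set` S] `<=` I ->
      extend_empty E E0 S t w = extend_empty E E0 (S `&` A t)%fset t w.

Definition FDP (S : set nat) (D : {fset nat}) : R :=
  #|` [fset i in D | i \in S]%fset|%:R / (maxn #|` D| 1)%:R.

(* The constraint FDP_S'(D) <= alpha E^S_t, as an event. *)
Definition constraint (alpha : R) E t (S' : set nat) (S D : {fset nat}) :
    set T :=
  [set w | ((FDP S' D)%:E <= alpha%:E * E S t w)%E].

Definition admissible (alpha : R) A E t (w : T) : set {fset nat} :=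
  [set D | (D `<=` A t)%fset /\
     forall S : {fset nat}, (S `<=` A t)%fset -> S != fset0 ->
       constraint alpha E t [set` S] S D w].

Definition horizon_admissible (alpha : R) A E (J : {fset nat}) t (w : T) :
    set {fset nat} :=
  [set D | (D `<=` A t)%fset /\
     forall S : {fset nat}, (S `<=` J)%fset -> (S `&` A t)%fset != fset0 ->
       constraint alpha E t [set` (S `&` A t)%fset] S D w].

End Collections.

(* Main.v *)
Require Import Defs.
From HB Require Import structures.
From mathcomp Require Import all_boot all_order all_algebra.
From mathcomp Require Import finmap.
From mathcomp Require Import all_classical all_reals all_analysis.
From mathcomp Require Import measurable_realfun.

Import Order.TTheory GRing.Theory Num.Theory.

Local Open Scope classical_set_scope.
Local Open Scope ring_scope.

(** A current constraint is the horizon constraint of the same set, because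
    [S] included in [A t] satisfies [S = S `&` A t]; so enlarging the horizon
    can only remove rejection sets.  Nothing is removed under coherence: the
    constraint of [S] at the horizon has the same left-hand side as the current
    constraint of [S `&` A t], and its right-hand side is at least as large, as
    [alpha] is nonnegative ([constraint_le]).  Under projective consistency the
    two right-hand sides are equal, and hence so are the two events
    ([projectively_consistent_eq]). *)

Section Constraints.
Local Set Implicit Arguments.
Local Unset Strict Implicit.
Context {d : measure_display} {T : measurableType d} {R : realType}.
Implicit Types (F : nat -> set (set T)) (I : set nat) (A : nat -> {fset nat}).
Implicit Types (E : {fset nat} -> nat -> T -> \bar R) (alpha : R).

Lemma constraint_le alpha E t (U : set nat) (S S' D : {fset nat}) w :
  0 <= alpha -> (E S t w <= E S' t w)%E ->
  constraint alpha E t U S D w -> constraint alpha E t U S' D w.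
Proof.
move=> alpha_ge0 leE; rewrite /constraint /= => /le_trans; apply.
by apply: lee_wpmul2l => //; rewrite lee_fin.
Qed.

Lemma horizon_admissible_sub alpha A E (J : {fset nat}) t w :
  (A t `<=` J)%fset ->
  horizon_admissible alpha A E J t w `<=` admissible alpha A E t w.
Proof.
move=> AJ D [DA hD]; split=> // S SA S0.
have SAE : (S `&` A t)%fset = S by apply/fsetIidPl.
by have := hD S (fsubset_trans SA AJ); rewrite SAE; apply.
Qed.

Lemma sub_horizon_admissible alpha I A E (J : {fset nat}) t w :
  0 <= alpha -> future_extension_coherent I A E -> [set` J] `<=` I ->
  admissible alpha A E t w `<=` horizon_admissible alpha A E J t w.
Proof.
move=> alpha_ge0 coh JI D [DA hD]; split=> // S SJ SA0.
apply: (constraint_le alpha_ge0 _ (hD _ (fsubsetIr _ _) SA0)).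
by apply: coh => // i /= iS; apply: JI; apply: (fsubsetP SJ).
Qed.

(** Since [S] contains the nonempty [S `&` A t], the collection extended to the
    empty set takes the value of [E] at both sets. *)
Lemma projectively_consistent_eq F I A E t (S : {fset nat}) w :
  projectively_consistent F I A E ->
  [set` S] `<=` I -> (S `&` A t)%fset != fset0 ->
  E S t w = E (S `&` A t)%fset t w.
Proof.
case=> E0 _ proj SI SA0; have := proj S t w SI.
have S0 : S != fset0 by apply: contraNneq SA0 => ->; rewrite fset0I.
by rewrite /extend_empty (negbTE S0) (negbTE SA0).
Qed.

End Constraints.

Theorem proposition3p1 (R : realType) (d : measure_display)
    (T : measurableType d) (F : nat -> set (set T))
    (M : set (probability T R)) (I : set nat)
    (H : nat -> set (probability T R)) (A : nat -> {fset nat})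
    (alpha : R) (E : {fset nat} -> nat -> T -> \bar R) :
  filtration F ->
  (forall i, I i -> H i `<=` M) ->
  active_sets I A ->
  0 < alpha <= 1 ->
  intersection_e_collection F M H I E ->
  (future_extension_coherent I A E ->
     forall (t : nat) (J : {fset nat}),
       [set` J] `<=` I -> (A t `<=` J)%fset ->
       forall w : T,
         horizon_admissible alpha A E J t w = admissible alpha A E t w) /\
  (projectively_consistent F I A E ->
     forall (t : nat) (J : {fset nat}),
       [set` J] `<=` I -> (A t `<=` J)%fset ->
       forall D S : {fset nat},
         (D `<=` A t)%fset -> (S `<=` J)%fset -> (S `&` A t)%fset != fset0 ->
         constraint alpha E t [set` (S `&` A t)%fset] S D =
         constraint alpha E t [set` (S `&` A t)%fset] (S `&` A t)%fset D).
Proof.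
move=> _ _ _ /andP[/ltW alpha_ge0 _] _; split.
  move=> coh t J JI AJ w; apply/seteqP; split.
    exact: horizon_admissible_sub.
  exact: (sub_horizon_admissible alpha_ge0 coh JI).
move=> proj t J JI _ D S _ SJ SA0; apply/seteqP.
have SI : [set` S] `<=` I by move=> i /= iS; apply: JI; apply: (fsubsetP SJ).
by split=> w; rewrite /constraint /= (projectively_consistent_eq w proj SI SA0).
Qed.
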